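(* Let $A\in\mathbf R^{n\times n}$, $B\in\mathbf R^{n\times m}$, $C\in\mathbf R^{m\times n}$ be such that the system $(A,B,C)$ is invertible, and suppose $n_{\mathrm i}^*=n_{\mathrm i}^*(A,B,C)\ge 3$. Fix any choice of matrices $F_1,\dots,F_{n_{\mathrm i}^*}$, $F$, $R$ as described in the context, and let $S_i(L)$, $\Phi_{i\sim j}$, $\Psi_j$ be the matrices defined there. Let $L\in\mathbf R^{n\times m}$. Then there exists a nonsingular matrix $T_y\in\mathbf R^{m\times m}$ such that the system $(A+LC,B,T_yC)$ has a regular relative degree if and only if $L$ satisfies the following linear matrix equations: $$\Phi_{(i+j)\sim n_{\mathrm i}^*}\,S_i(L)\,\Psi_j=0,\qquad j=1,2,\dots,n_{\mathrm i}^*-i,\quad i=2,3,\dots,n_{\mathrm i}^*-1 .$$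
   Context: A system $(A,B,C)$ means $\dot x=Ax+Bu,\ y=Cx$ with $x\in\mathbf R^n$, $u,y\in\mathbf R^m$ and real constant matrices. Regular relative degree: let $c_1,\dots,c_m$ be the rows of $C$. The system $(A,B,C)$ has relative degree $\{r_1,\dots,r_m\}$ (ordered, $1\le r_i\le n$) if for each $i$, $c_iA^jB=0$ for $j=0,\dots,r_i-2$ and $c_iA^{r_i-1}B\ne0$. It is regular if the $m\times m$ coupling matrix with rows $c_1A^{r_1-1}B,\dots,c_mA^{r_m-1}B$ is nonsingular. ''Has a regular relative degree'' means the relative degree exists and is regular. Invertible: the transfer function $C(sI-A)^{-1}B$ has normal rank (maximal rank over $s\in\mathbf C$) equal to $m$. Invertibility matrices: for $i=1,\dots,n$, $Q_{\mathrm i}^{[i]}=Q_{\mathrm i}^{[i]}(A,B,C)\in\mathbf R^{mi\times mi}$ is the $i\times i$ block matrix whose $(j,k)$ block ($m\times m$) is $0$ if $j+k\le i$ and $CA^{j+k-i-1}B$ if $j+k\ge i+1$. Invertibility indices: $\varphi^{[1]}=\mathrm{rank}(Q_{\mathrm i}^{[1]})$, $\varphi^{[i]}=\mathrm{rank}(Q_{\mathrm i}^{[i]})-\mathrm{rank}(Q_{\mathrm i}^{[i-1]})$ for $i\ge2$. It is known that $\varphi^{[1]}\le\cdots\le\varphi^{[n]}$ and that the system is invertible iff $\varphi^{[n]}=m$. For an invertible system, $n_{\mathrm i}^*=\min\{i\in\{1,\dots,n\}:\varphi^{[i]}=m\}$. Put $\psi_1=\varphi^{[1]}$, $\psi_i=\varphi^{[i]}-\varphi^{[i-1]}\ge0$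 for $2\le i\le n_{\mathrm i}^*$, so that $\sum_{i=1}^{n_{\mathrm i}^*}\psi_i=m$. Write $\nu=n_{\mathrm i}^*$ below. Matrices $E_i$: in the reduced row-echelon form of $Q_{\mathrm i}^{[\nu]}$, with columns divided into $\nu$ blocks of width $m$, let $E_i$ be the $i$-th column block of those nonzero rows whose pivot lies in the $i$-th column block; thus the nonzero rows form a block upper-triangular matrix with diagonal blocks $E_1,\dots,E_\nu$. Each $E_i$ has $m$ columns, $\varphi^{[i]}$ rows and full row rank. Matrices $F_i$, $F$, $R$: choose $F_i\in\mathbf R^{\psi_i\times m}$ of rank $\psi_i$, $i=1,\dots,\nu$, with $\mathrm{im}(F_i^{\mathrm T})\setminus\{0\}\subseteq\mathrm{im}(E_i^{\mathrm T})\setminus\mathrm{im}(E_{i-1}^{\mathrm T})$, where $\mathrm{im}(E_0^{\mathrm T})=\{0\}$ (a matrix with zero rows has row space $\{0\}$). Then there is $R\in\mathbf R^{m\times m\nu}$ such that $RQ_{\mathrm i}^{[\nu]}=F$, where $F\in\mathbf R^{m\times m\nu}$ is block upper triangular (row blocks of heights $\psi_1,\dots,\psi_\nu$, column blocks of width $m$) with diagonal blocks $F_1,\dots,F_\nu$, zeros below them, and unspecified blocks above them. ($R$ and $F$ are not unique; fix any such choice.) Partition $R=[R_\nu\ \cdots\ R_2\ R_1]$ with $R_i\in\mathbf R^{m\times m}$; $R_1$ is nonsingular. Matrix $S(L)$: let $\Omega_{\mathrm o}^{[\nu]}(L)\in\mathbf R^{m\nu\times m\nu}$ be the block lower-triangular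 Toeplitz matrix with $(j,k)$ block $I_m$ if $j=k$, $-CA^{j-k-1}L$ if $j>k$, and $0$ if $j<k$. Define $S(L)=R\,\Omega_{\mathrm o}^{[\nu]}(L)\,(I_\nu\otimes R_1^{-1})\in\mathbf R^{m\times m\nu}$, partitioned as $S(L)=[S_\nu(L)\ \cdots\ S_3(L)\ S_2(L)\ I_m]$ with $S_i(L)\in\mathbf R^{m\times m}$. Selection matrices: $\psi_{i\sim j}=\sum_{k=i}^j\psi_k$ (equal to $0$ if $j<i$), and $\Phi_{i\sim j}=[\,0_{\psi_{i\sim j}\times\psi_{1\sim(i-1)}}\ \ I_{\psi_{i\sim j}}\ \ 0_{\psi_{i\sim j}\times\psi_{(j+1)\sim\nu}}\,]\in\mathbf R^{\psi_{i\sim j}\times m}$; $\Psi_i\in\mathbf R^{m\times\psi_i}$ is the matrix obtained by stacking $0_{\psi_{1\sim(i-1)}\times\psi_i}$, $I_{\psi_i}$, $0_{\psi_{(i+1)\sim\nu}\times\psi_i}$. Equations between empty matrices (zero rows or zero columns) hold vacuously. *)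

(* Defs.v *)
From HB Require Import structures.
From mathcomp Require Import all_boot all_order all_algebra.
From mathcomp Require Import complex reals.

Set Implicit Arguments.
Unset Strict Implicit.
Unset Printing Implicit Defensive.

Import Order.TTheory GRing.Theory Num.Theory.
Local Open Scope ring_scope.

(* A matrix with nu column blocks of width m has \sum_(k < nu) m columns, so
   that the block-matrix operations of matrix.v apply. [colblk M k] is its k-th
   column block counted from 1; it is 0 when k is not in {1, ..., nu}. *)
Definition colblk (K : realType) (p m nu : nat)
    (M : 'M[K]_(p, \sum_(k < nu) m)) (k : nat) : 'M[K]_(p, m) :=
  if k is k'.+1 then
    if insub k' is Some l then @submxrow K nu (fun=> m) p M l else 0
  else 0.

Definition is_pivot (K : realType) (p q : nat) (M : 'M[K]_(p, q))
    (r : 'I_p) (c : 'I_q) : bool :=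
  (M r c != 0) && [forall k : 'I_q, (k < c)%N ==> (M r k == 0)].

Definition is_rref (K : realType) (p q : nat) (M : 'M[K]_(p, q)) : Prop :=
  [/\ forall r c, is_pivot M r c -> M r c = 1,
      forall r c, is_pivot M r c -> forall r', r' != r -> M r' c = 0,
      forall r c r' c', is_pivot M r c -> is_pivot M r' c' ->
        (r < r')%N -> (c < c')%N
    & forall r r' : 'I_p, (r < r')%N -> row r M = 0 -> row r' M = 0].

Definition rref_of (K : realType) (p q : nat) (M U : 'M[K]_(p, q)) : Prop :=
  is_rref U /\ exists2 P : 'M[K]_p, P \in unitmx & U = P *m M.

(* For a reduced row-echelon matrix U, [Eblk U k] is the matrix E_k. No row has
   its pivot in a column block numbered 0, so [Eblk U 0] has zero rows. *)
Definition pivot_rows (K : realType) (p m nu : nat)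
    (U : 'M[K]_(p, \sum_(k < nu) m)) (k : nat) : {set 'I_p} :=
  [set r | [exists c, is_pivot U r c &&
                      ((@tagnat.sig1 nu (fun=> m) c).+1 == k)]].

Definition Eblk (K : realType) (p m nu : nat)
    (U : 'M[K]_(p, \sum_(k < nu) m)) (k : nat) :
    'M[K]_(#|pivot_rows U k|, m) :=
  rowsub (fun a : 'I_#|pivot_rows U k| => enum_val a) (colblk U k).

Section System.

Variables (K : realType) (n m : nat).
Variables (A : 'M[K]_n) (B : 'M[K]_(n, m)) (C : 'M[K]_(m, n)).

Definition transfer (s : K[i]) : 'M[K[i]]_m :=
  let toC := real_complex K in
  map_mx toC C *m invmx (s%:M - map_mx toC A) *m map_mx toC B.

(* [invmx] is total, so the poles of the transfer function are excluded. *)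
Definition has_normal_rank (d : nat) : Prop :=
  let regular (s : K[i]) := s%:M - map_mx (real_complex K) A \in unitmx in
  (exists2 s, regular s & \rank (transfer s) = d) /\
  (forall s, regular s -> (\rank (transfer s) <= d)%N).

Definition invertible : Prop := has_normal_rank m.

Definition has_relative_degree (r : 'I_m -> nat) : Prop :=
  forall i : 'I_m,
    [/\ (1 <= r i <= n)%N,
        forall j : nat, (j.+2 <= r i)%N -> row i C *m A ^+ j *m B = 0
      & row i C *m A ^+ (r i).-1 *m B != 0].

Definition coupling_mx (r : 'I_m -> nat) : 'M[K]_m :=
  \matrix_(i < m) (row i C *m A ^+ (r i).-1 *m B).

Definition has_regular_relative_degree : Prop :=
  exists2 r : 'I_m -> nat, has_relative_degree r & coupling_mx r \in unitmx.

(* With j and k counted from 0, the 1-based condition j + k <= i reads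
   j + k + 2 <= i, and the exponent j + k - i - 1 becomes j + k + 1 - i. *)
Definition Qi (i : nat) : 'M[K]_(\sum_(j < i) m, \sum_(k < i) m) :=
  \mxblock_(j < i, k < i)
    (if (j + k + 2 <= i)%N then 0 else C *m A ^+ (j + k + 1 - i) *m B).

(* [Qi 0] is the empty matrix, so phi 1 = \rank (Qi 1) and psi 1 = phi 1.
   The truncated subtractions are exact: Qi i.-1 is a submatrix of Qi i, and
   phi is nondecreasing on {1, ..., n}. *)
Definition phi (i : nat) : nat := (\rank (Qi i) - \rank (Qi i.-1))%N.

Definition psi (i : nat) : nat := (phi i - phi i.-1)%N.

(* nu is the least element of {1, ..., n} such that phi nu = m. *)
Definition is_nistar (nu : nat) : Prop :=
  [/\ (1 <= nu <= n)%N, phi nu = m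
    & forall i : nat, (1 <= i < nu)%N -> phi i <> m].

Definition psi_sum (i j : nat) : nat := \sum_(i <= k < j.+1) psi k.

(* The identity block of Phi_{i~j} starts after psi_sum 1 i.-1 zero columns. *)
Definition Phi (i j : nat) : 'M[K]_(psi_sum i j, m) :=
  \matrix_(a < psi_sum i j, b < m) (b == psi_sum 1 i.-1 + a :> nat)%:R.

Definition Psi (i : nat) : 'M[K]_(m, psi i) :=
  \matrix_(a < m, b < psi i) (a == psi_sum 1 i.-1 + b :> nat)%:R.

(* v ranges over row vectors: v^T is in im (M^T) iff (v <= M)%MS. *)
Definition F_choice (nu : nat)
    (U : 'M[K]_(\sum_(j < nu) m, \sum_(k < nu) m))
    (Fd : forall i : nat, 'M[K]_(psi i, m)) : Prop :=
  forall i : nat, (1 <= i <= nu)%N ->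
    \rank (Fd i) = psi i /\
    forall v : 'rV[K]_m, (v <= Fd i)%MS -> v != 0 ->
      (v <= Eblk U i)%MS /\ ~~ (v <= Eblk U i.-1)%MS.

(* (Psi i)^T *m _ extracts the i-th row block, of height psi i. *)
Definition block_upper (nu : nat) (Fd : forall i : nat, 'M[K]_(psi i, m))
    (F : 'M[K]_(m, \sum_(k < nu) m)) : Prop :=
  forall i : nat, (1 <= i <= nu)%N ->
    (Psi i)^T *m colblk F i = Fd i /\
    forall k : nat, (1 <= k < i)%N -> (Psi i)^T *m colblk F k = 0.

Definition Omega_o (nu : nat) (L : 'M[K]_(n, m)) :
    'M[K]_(\sum_(j < nu) m, \sum_(k < nu) m) :=
  \mxblock_(j < nu, k < nu)
    (if j == k then 1%:M
     else if (k < j)%N then - (C *m A ^+ (j - k - 1) *m L) else 0).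

(* R = [R_nu ... R_2 R_1]: the blocks are numbered from the right. *)
Definition rblk (nu : nat) (M : 'M[K]_(m, \sum_(k < nu) m)) (i : nat) : 'M[K]_m :=
  colblk M (nu.+1 - i).

(* The block-diagonal factor is I_nu (x) R_1^-1. *)
Definition Smx (nu : nat) (R : 'M[K]_(m, \sum_(k < nu) m)) (L : 'M[K]_(n, m)) :
    'M[K]_(m, \sum_(k < nu) m) :=
  R *m Omega_o nu L *m \mxdiag_(k < nu) invmx (rblk R 1).

End System.

(* Main.v *)
(* Encode matrix sequences as power series in z: M(z) is the series of Markov
   parameters C A^p B, M_L(z) that of (A + L C, B, C), and W(z) the series of
   Omega_o, so that M = W M_L. With S(z) = R(z) W(z) R_1^-1, which has constant
   term I, and N(z) = R_1 M_L(z), the relation R Q = F reads S N = F modulo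
   z^nu. Row x of F, lying in row block b(x), has order exactly z^(b(x)-1), and
   its leading rows form a nonsingular matrix; the equations of the theorem say
   that S(z) x y = O(z^(b(x)-b(y))).
   If they hold, N inherits from F the row orders b(x) - 1 and a nonsingular
   matrix of leading rows, so T_y = R_1 works. Conversely let T_y M_L have row
   orders r(y) - 1 with nonsingular leading rows, and put V = R_1 T_y^-1. From
   (S V) (T_y M_L) = F one gets (S V) x y = O(z^(b(x)-r(y))). Since nonzero
   vectors of im (F_i^T) are not in im (E_(i-1)^T), the constant matrix V^-1
   satisfies V^-1 y z = 0 when b(z) < r(y), and S = (S V) V^-1. *)
Require Import Defs.
From mathcomp Require Import all_boot all_order all_algebra.
From mathcomp Require Import complex reals.
From mathcomp Require Import zify.

Set Implicit Arguments.
Unset Strict Implicit.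
Unset Printing Implicit Defensive.

Import Order.TTheory GRing.Theory Num.Theory.
Local Open Scope ring_scope.

Local Arguments colblk : simpl never.

(** * Block rows and their column blocks *)

Section ColumnBlocks.

Variables (K : realType) (m nu : nat).

(** [G] is indexed from 0 but [colblk] from 1, so [blockrow nu (colblk X)] is X moved one block to
    the right, with a zero block entering on the left. *)
Definition blockrow (p : nat) (G : nat -> 'M[K]_(p, m)) :
    'M[K]_(p, \sum_(k < nu) m) :=
  @mxrow K nu (fun=> m) p (fun k : 'I_nu => G k).

Lemma colblk0 (p : nat) (M : 'M[K]_(p, \sum_(k < nu) m)) : colblk M 0 = 0.
Proof. by []. Qed.

Lemma colblk_ord (p : nat) (M : 'M[K]_(p, \sum_(k < nu) m)) (k : 'I_nu) :
  colblk M k.+1 = @submxrow K nu (fun=> m) p M k.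
Proof. by rewrite /colblk valK. Qed.

Lemma colblk_out (p : nat) (M : 'M[K]_(p, \sum_(k < nu) m)) (k : nat) :
  (nu < k)%N -> colblk M k = 0.
Proof. by case: k => // k; rewrite /colblk ltnS => ltk; rewrite insubN // -leqNgt. Qed.

Lemma colblk_blockrow (p : nat) (G : nat -> 'M[K]_(p, m)) (k : nat) :
  (0 < k <= nu)%N -> colblk (blockrow G) k = G k.-1.
Proof.
by case: k => // k ltk; rewrite (colblk_ord _ (Ordinal ltk)) mxrowK.
Qed.

Lemma colblk_mulmx (p q : nat) (N : 'M[K]_(p, q))
    (M : 'M[K]_(q, \sum_(k < nu) m)) (k : nat) :
  colblk (N *m M) k = N *m colblk M k.
Proof.
case: k => [|k]; first by rewrite !colblk0 mulmx0.
by rewrite /colblk; case: insubP => [l _ _|_]; rewrite ?mulmx0 // mul_submxrow.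
Qed.

Lemma colblkB (p : nat) (M N : 'M[K]_(p, \sum_(k < nu) m)) (k : nat) :
  colblk (M - N) k = colblk M k - colblk N k.
Proof.
case: k => [|k]; first by rewrite !colblk0 subr0.
by rewrite /colblk; case: insubP => [l _ _|_]; rewrite ?subr0 // submxrowB.
Qed.

Lemma colblkE (p : nat) (M : 'M[K]_(p, \sum_(k < nu) m)) (i : 'I_p)
    (c : 'I_(\sum_(k < nu) m)) :
  M i c = colblk M (@tagnat.sig1 nu (fun=> m) c).+1 i (@tagnat.sig2 nu (fun=> m) c).
Proof. by rewrite colblk_ord mxE tagnat.sig2K. Qed.

Lemma colblk_mul_mxblock (p : nat) (X : 'M[K]_(p, \sum_(k < nu) m))
    (G : 'I_nu -> 'I_nu -> 'M[K]_m) (k : 'I_nu) :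
  colblk (X *m @mxblock K nu nu (fun=> m) (fun=> m) G) k.+1 =
  \sum_(j < nu) colblk X j.+1 *m G j k.
Proof.
rewrite colblk_ord -{1}(@submxrowK K nu (fun=> m) p X) mul_mxrow_mxblock mxrowK.
by apply: eq_bigr => j _; rewrite colblk_ord.
Qed.

Lemma colblk_mul_mxdiag (p : nat) (X : 'M[K]_(p, \sum_(k < nu) m))
    (N : 'M[K]_m) (k : nat) :
  colblk (X *m @mxdiag K nu (fun=> m) (fun=> N)) k = colblk X k *m N.
Proof.
case: k => [|k]; first by rewrite !colblk0 mul0mx.
case: (ltnP k nu) => [ltk|?]; last by rewrite !colblk_out ?mul0mx.
rewrite !(colblk_ord _ (Ordinal ltk)) -{1}(@submxrowK K nu (fun=> m) p X).
by rewrite mul_mxrow_mxdiag mxrowK.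
Qed.

End ColumnBlocks.

(** * The invertibility matrix as multiplication by the Markov series *)

Section InvertibilityMatrix.

Variables (K : realType) (n m nu : nat).
Variables (A : 'M[K]_n) (B : 'M[K]_(n, m)) (C : 'M[K]_(m, n)).

(** A Cauchy product: with block nu - q of X as coefficient of z^q, the right-hand side is the
    coefficient of z^k in X(z) M(z). *)
Lemma colblk_mul_Qi (p : nat) (X : 'M[K]_(p, \sum_(k < nu) m)) (k : nat) :
  (k < nu)%N ->
  colblk (X *m Qi A B C nu) k.+1 =
  \sum_(q < k.+1) colblk X (nu - q) *m (C *m A ^+ (k - q) *m B).
Proof.
move=> ltk; rewrite (colblk_mul_mxblock _ _ (Ordinal ltk)) /=.
rewrite (reindex_inj rev_ord_inj) /=.
rewrite (big_ord_widen nu (fun q => colblk X (nu - q) *m (C *m A ^+ (k - q) *m B))) //.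
rewrite [RHS]big_mkcond /=; apply: eq_bigr => q _.
have ltq := ltn_ord q.
have -> : (nu - q.+1 + k + 2 <= nu)%N = ~~ (q < k.+1)%N by lia.
case: (ltnP q k.+1) => [leq|?] /=; last by rewrite mulmx0.
have -> : ((nu - q.+1).+1 = nu - q)%N by lia.
by have -> : (nu - q.+1 + k + 1 - nu = k - q)%N by lia.
Qed.

(** Multiplication of X(z) by z: blocks move left, and the coefficient of z^(nu-1) is lost modulo
    z^nu. *)
Lemma colblk_shift_up (p : nat) (X : 'M[K]_(p, \sum_(k < nu) m)) (k : nat) :
  (k < nu)%N ->
  colblk (blockrow nu (fun j => colblk X j.+2) *m Qi A B C nu) k.+1 =
  colblk (X *m Qi A B C nu) k.
Proof.
move=> ltk; rewrite colblk_mul_Qi // big_ord_recl subn0.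
rewrite colblk_blockrow; last lia.
rewrite (@colblk_out _ _ _ _ X nu.-1.+2) ?mul0mx ?add0r; last lia.
case: k ltk => [|k] ltk; first by rewrite big_ord0.
rewrite colblk_mul_Qi; last lia.
apply: eq_bigr => q _; have := ltn_ord q => ltq.
rewrite lift0 subSS colblk_blockrow; last lia.
by have -> : ((nu - q.+1).-1.+2 = nu - q)%N by lia.
Qed.

(** Division by z, possible because the constant term [colblk X nu] is zero. *)
Lemma colblk_shift_down (p : nat) (X : 'M[K]_(p, \sum_(k < nu) m)) (k : nat) :
  (k < nu)%N -> colblk X nu = 0 ->
  colblk (blockrow nu (colblk X) *m Qi A B C nu) k =
  colblk (X *m Qi A B C nu) k.+1.
Proof.
move=> ltk X0; rewrite [RHS]colblk_mul_Qi // big_ord_recl subn0 X0 mul0mx add0r.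
case: k ltk => [|k] ltk; first by rewrite big_ord0.
rewrite colblk_mul_Qi; last lia.
apply: eq_bigr => q _; have := ltn_ord q => ltq.
rewrite lift0 subSS colblk_blockrow; last lia.
by have -> : ((nu - q).-1 = nu - q.+1)%N by lia.
Qed.

Lemma expr_output_injection (L : 'M[K]_(n, m)) (k : nat) :
  (A + L *m C) ^+ k =
  A ^+ k + \sum_(q < k) A ^+ q *m (L *m C) *m (A + L *m C) ^+ (k - q.+1).
Proof.
elim: k => [|k IH]; first by rewrite big_ord0 addr0.
rewrite exprS mulrDl {1}IH mulrDr -exprS -addrA; congr (_ + _).
rewrite big_ord_recl expr0 !mul1mx subn1 /= addrC; congr (_ + _).
rewrite mulr_sumr; apply: eq_bigr => q _.
by rewrite /bump add1n subSS exprS -!mulmxE !mulmxA.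
Qed.

Lemma markov_output_injection (L : 'M[K]_(n, m)) (k : nat) :
  C *m A ^+ k *m B =
  C *m (A + L *m C) ^+ k *m B -
  \sum_(q < k) (C *m A ^+ q *m L) *m (C *m (A + L *m C) ^+ (k - q.+1) *m B).
Proof.
rewrite {1}expr_output_injection mulmxDr mulmxDl mulmx_sumr mulmx_suml.
under [X in _ = _ - X]eq_bigr do rewrite !mulmxA.
under [X in (_ + X) - _]eq_bigr do rewrite !mulmxA.
by rewrite addrK.
Qed.

(** The block form of M = W M_L; each block is an instance of [markov_output_injection], the
    diagonal of [Omega_o] giving its first term. *)
Lemma Qi_output_injection (L : 'M[K]_(n, m)) :
  Qi A B C nu = Omega_o A C nu L *m Qi (A + L *m C) B C nu.
Proof.
rewrite /Qi /Omega_o mul_mxblock; apply: eq_mxblock => i j.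
have ltj := ltn_ord j; have lti := ltn_ord i.
rewrite (bigD1 i) //= eqxx mul1mx.
rewrite (eq_bigr (fun k : 'I_nu => if (k < i)%N && (nu <= k + j + 1)%N then
  - (C *m A ^+ (i - k - 1) *m L *m (C *m (A + L *m C) ^+ (k + j + 1 - nu) *m B))
  else 0)); last first.
  move=> k nki; rewrite eq_sym (negPf nki).
  case: (ltnP k i) => [lki|_] /=; last by rewrite mul0mx.
  have -> : (k + j + 2 <= nu)%N = ~~ (nu <= k + j + 1)%N by lia.
  by case: (leqP nu) => /= _; rewrite ?mulmx0 // mulNmx.
case: ifP => [le|gt].
  rewrite big1 ?addr0 // => k _; case: ifP => //; lia.
rewrite (markov_output_injection L); congr (_ + _).
rewrite -sumrN -big_mkcondr /=.
pose G k := - (C *m A ^+ (i - k - 1) *m L *m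
  (C *m (A + L *m C) ^+ (k + j + 1 - nu) *m B)).
rewrite (eq_bigl (fun k : 'I_nu => (nu <= k + j + 1)%N && (k < i)%N)); last first.
  by move=> k; rewrite -val_eqE /=; lia.
rewrite -(big_ord_widen_cond nu (fun k => nu <= k + j + 1)%N G); last lia.
(* The reversal k = i - 1 - q matches the powers of A on both sides. *)
apply: esym; rewrite (reindex_inj rev_ord_inj) /=.
rewrite (big_ord_widen i (fun q => - (C *m A ^+ q *m L *m (C *m
     (A + L *m C) ^+ (i + j + 1 - nu - q.+1) *m B)))); last lia.
apply: eq_big => q; first by have := ltn_ord q; lia.
move=> _; have ltq := ltn_ord q; rewrite /G.
have -> : (i - (i - q.+1) - 1 = q)%N by lia.
by have -> : (i - q.+1 + j + 1 - nu = i + j + 1 - nu - q.+1)%N by lia.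
Qed.

End InvertibilityMatrix.

(** * Leading blocks of a reduced row-echelon matrix *)

Section EchelonBlocks.

Variables (K : realType) (p m nu : nat).
Variable U : 'M[K]_(p, \sum_(k < nu) m).

Lemma pivot_exists (r : 'I_p) : row r U != 0 -> exists c, is_pivot U r c.
Proof.
move=> /rV0Pn[c0]; rewrite mxE => Uc0.
case: (@arg_minnP _ c0 (fun c => U r c != 0) val Uc0) => c Uc minc.
exists c; rewrite /is_pivot Uc; apply/forallP => k; apply/implyP => ltk.
by apply: contraTT ltk => Uk; rewrite -leqNgt; apply: minc.
Qed.

(** [sig1] counts from 0, so the bound on k places block k strictly to the left of the block of the
    pivot. *)
Lemma row_colblk_pivot (r : 'I_p) (c : 'I_(\sum_(k < nu) m)) (k : nat) :
  is_pivot U r c -> (k <= @tagnat.sig1 nu (fun=> m) c)%N ->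
  row r (colblk U k) = 0.
Proof.
move=> /andP[_ /forallP Ur0]; case: k => [|k] lek; first by rewrite colblk0 row0.
have ltk : (k < nu)%N by apply: ltn_trans lek (ltn_ord _).
apply/rowP => j; rewrite !mxE (colblk_ord _ (Ordinal ltk)) mxE; apply/eqP.
apply: (implyP (Ur0 _)); rewrite ltnNge; apply/negP => lec.
have := @tagnat.le_sig1 nu (fun=> m) _ _ lec.
by rewrite tagnat.Rank1K leEord /= leqNgt lek.
Qed.

Lemma Eblk_sub_leading (i : nat) (v : 'rV[K]_m) :
  (v <= Eblk U i)%MS ->
  exists2 x : 'rV[K]_p, colblk (x *m U) i = v
    & forall k, (k < i)%N -> colblk (x *m U) k = 0.
Proof.
move=> /submxP[D ->]; set f := fun a : 'I_#|pivot_rows U i| => enum_val a.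
have E k : colblk (D *m rowsub f 1%:M *m U) k = D *m rowsub f (colblk U k).
  by rewrite colblk_mulmx -mulmxA mul_rowsub_mx mul1mx.
exists (D *m rowsub f 1%:M); first by rewrite E.
move=> k lek; rewrite E; suff -> : rowsub f (colblk U k) = 0 by rewrite mulmx0.
apply/row_matrixP => a; rewrite row_rowsub row0.
have := enum_valP a; rewrite inE => /existsP[c /andP[piv /eqP ci]].
by apply: (row_colblk_pivot piv); rewrite -ltnS ci.
Qed.

(** A pivot column has a single nonzero entry, 1, so [y *m U] shows there the coefficient of the
    pivot row. Hence rows with a pivot before block i have coefficient 0, and those with a later
    pivot vanish in block i. *)
Lemma leading_sub_Eblk (i : nat) (y : 'rV[K]_p) :
  is_rref U -> (forall k, (k < i)%N -> colblk (y *m U) k = 0) ->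
  (colblk (y *m U) i <= Eblk U i)%MS.
Proof.
move=> [piv1 piv0 _ _] yU0; rewrite colblk_mulmx mulmx_sum_row.
apply: summx_sub => r _.
have [Ur0|/pivot_exists[c piv]] := eqVneq (row r U) 0.
  by rewrite rowE -colblk_mulmx -rowE Ur0 -(mul0mx _ U) colblk_mulmx mul0mx scaler0
    sub0mx.
have [lti|gti|eqi] := ltngtP (@tagnat.sig1 nu (fun=> m) c).+1 i.
- have := yU0 _ lti; move=> /rowP/(_ (@tagnat.sig2 nu (fun=> m) c)).
  rewrite -colblkE !mxE (bigD1 r) //= (piv1 _ _ piv) mulr1 big1 => [|r' neq].
    by rewrite addr0 => ->; rewrite scale0r sub0mx.
  by rewrite (piv0 _ _ piv) ?mulr0.
- by rewrite (row_colblk_pivot piv) ?scaler0 ?sub0mx.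
have rin : r \in pivot_rows U i.
  by rewrite inE; apply/existsP; exists c; rewrite piv eqi eqxx.
apply: scalemx_sub.
have -> : row r (colblk U i) = row (enum_rank_in rin r) (Eblk U i).
  by rewrite row_rowsub enum_rankK_in.
exact: row_sub.
Qed.

End EchelonBlocks.

(** * Row spaces of the E_i as spaces of leading coefficients *)

Section LeadingSubspaces.

Variables (K : realType) (n m nu : nat).
Variables (A : 'M[K]_n) (B : 'M[K]_(n, m)) (C : 'M[K]_(m, n)).
Variable U : 'M[K]_(\sum_(j < nu) m, \sum_(k < nu) m).
Hypothesis rrefU : rref_of (Qi A B C nu) U.

(* With q a power series in z and M the Markov series, x encodes q modulo
   z^nu and the blocks of [x *m Qi A B C nu] are the coefficients of q M, so
   im (E_i^T) is the set of leading coefficients of order z^(i-1). *)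
Lemma Eblk_leadingP (i : nat) (v : 'rV[K]_m) :
  reflect (exists2 x : 'rV[K]_(\sum_(j < nu) m),
             colblk (x *m Qi A B C nu) i = v
             & forall k, (k < i)%N -> colblk (x *m Qi A B C nu) k = 0)
          (v <= Eblk U i)%MS.
Proof.
apply: (iffP idP); have [rU [P unitP eU]] := rrefU.
  move=> /Eblk_sub_leading[x xi x0].
  by exists (x *m P); rewrite -mulmxA -eU.
move=> [x <- x0]; have eQ : Qi A B C nu = invmx P *m U by rewrite eU mulKmx.
move: x0; rewrite eQ mulmxA; exact: leading_sub_Eblk.
Qed.

(** Multiplying q by z raises the order of q M by one and keeps its leading coefficient. *)
Lemma Eblk_nested (i : nat) : (i < nu)%N -> (Eblk U i <= Eblk U i.+1)%MS.
Proof.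
move=> lti; apply/row_subP => a.
have /Eblk_leadingP[x xi x0] := row_sub a (Eblk U i).
apply/Eblk_leadingP; exists (blockrow nu (fun j => colblk x j.+2)).
  by rewrite colblk_shift_up.
by case=> // k ltk; rewrite colblk_shift_up ?x0 //; apply: ltn_trans lti.
Qed.

(** If q(0) = 0, then (q/z) M has the same leading coefficient as q M, one order lower. *)
Lemma Eblk_divided (i : nat) (x : 'rV[K]_(\sum_(j < nu) m)) :
  (i < nu)%N -> colblk x nu = 0 ->
  (forall k, (k <= i)%N -> colblk (x *m Qi A B C nu) k = 0) ->
  (colblk (x *m Qi A B C nu) i.+1 <= Eblk U i)%MS.
Proof.
move=> lti xnu x0; apply/Eblk_leadingP; exists (blockrow nu (colblk x)).
  exact: colblk_shift_down.
by move=> k ltk; rewrite colblk_shift_down ?x0 //; apply: ltn_trans lti.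
Qed.

End LeadingSubspaces.

(** * The number of the row block that contains a given row *)

Section BlockIndex.

Variables (w : nat -> nat) (nu : nat).

Let offset k := (\sum_(1 <= l < k.+1) w l)%N.

(** This is b(x). As [offset 0] is 0, the search never stops at 0 and blocks are numbered from 1; a
    row beyond all blocks gets [nu.+1]. *)
Definition block_index (x : nat) : nat :=
  find (fun k => (x < offset k)%N) (iota 0 nu.+1).

Lemma leq_offset (k l : nat) : (k <= l)%N -> (offset k <= offset l)%N.
Proof.
move=> lekl; rewrite /offset [leqRHS](big_cat_nat (n := k.+1)) //=.
exact: leq_addr.
Qed.

Lemma block_indexP (x : nat) : (x < offset nu)%N ->
  [/\ (0 < block_index x <= nu)%N, (offset (block_index x).-1 <= x)%N
    & (x < offset (block_index x))%N].
Proof.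
move=> ltx; set P := fun k => (x < offset k)%N.
have hasP : has P (iota 0 nu.+1).
  by apply/hasP; exists nu; rewrite // mem_iota ltnSn.
have := nth_find 0 hasP; have := hasP; rewrite has_find size_iota.
rewrite -/(block_index x); case E: (block_index x) => [|b] ltb.
  by rewrite nth_iota // /P /offset big_geq.
rewrite nth_iota // add0n => Pb; split=> //=.
have : (b < find P (iota 0 nu.+1))%N by rewrite -/(block_index x) E.
move=> /(before_find 0); rewrite nth_iota ?add0n /P => [|//]; first lia.
exact: ltnW.
Qed.

Lemma block_index_leq (x k : nat) : (k <= nu)%N ->
  (block_index x <= k)%N = (x < offset k)%N.
Proof.
move=> lek; apply/idP/idP => [leb|ltx].
  have ltx : (x < offset nu)%N.
    rewrite ltnNge; apply/negP => gex.
    suff : block_index x = nu.+1 by lia.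
    rewrite /block_index hasNfind ?size_iota //; apply/hasPn => l.
    rewrite mem_iota /= add0n ltnS -leqNgt => lel.
    exact: leq_trans (leq_offset lel) gex.
  have [_ _ ltb] := block_indexP ltx.
  exact: leq_trans ltb (leq_offset leb).
rewrite leqNgt; apply/negP => ltk.
by have := before_find 0 ltk; rewrite nth_iota ?add0n ?ltx.
Qed.

End BlockIndex.

(** * Selection matrices read entrywise *)

Section Selection.

Variables (K : realType) (n m : nat).
Variables (A : 'M[K]_n) (B : 'M[K]_(n, m)) (C : 'M[K]_(m, n)).

Lemma psi_sumE (i j : nat) :
  psi_sum A B C i j = (\sum_(i <= k < j.+1) psi A B C k)%N.
Proof. by []. Qed.

Lemma row_Phi (p i j : nat) (M : 'M[K]_(m, p)) (a : 'I_(psi_sum A B C i j))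
    (x : 'I_m) :
  x = (psi_sum A B C 1 i.-1 + a)%N :> nat ->
  row a (Phi A B C i j *m M) = row x M.
Proof.
move=> ex; rewrite row_mul [RHS]rowE; congr (_ *m M); apply/rowP => b.
(* The sum in [Phi] is the algebraic addition on nat, converted here to the usual one. *)
by rewrite !mxE eqxx -[Algebra.add _ _]/(_ + _)%N -ex val_eqE eq_sym.
Qed.

Lemma col_Psi (p j : nat) (M : 'M[K]_(p, m)) (b : 'I_(psi A B C j)) (y : 'I_m) :
  y = (psi_sum A B C 1 j.-1 + b)%N :> nat ->
  col b (M *m Psi A B C j) = col y M.
Proof.
move=> ey; rewrite [RHS]colE colE -mulmxA -colE; congr (M *m _); apply/colP => a.
by rewrite !mxE eqxx andbT -[Algebra.add _ _]/(_ + _)%N -ey val_eqE.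
Qed.

Lemma row_trPsi (p j : nat) (M : 'M[K]_(m, p)) (b : 'I_(psi A B C j)) (y : 'I_m) :
  y = (psi_sum A B C 1 j.-1 + b)%N :> nat ->
  row b ((Psi A B C j)^T *m M) = row y M.
Proof.
by move=> ey; apply: trmx_inj; rewrite !tr_row trmx_mul trmxK; apply: col_Psi.
Qed.

(** The product is the submatrix of M on the rows of blocks i to nu and the columns of block j. *)
Lemma Phi_mul_Psi_eq0 (i j nu : nat) (M : 'M[K]_m) :
  psi_sum A B C 1 nu = m -> (0 < i <= nu.+1)%N -> (0 < j <= nu)%N ->
  Phi A B C i nu *m M *m Psi A B C j = 0 <->
  forall x y : 'I_m, (i <= block_index (psi A B C) nu x)%N ->
    block_index (psi A B C) nu y = j -> M x y = 0.
Proof.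
set s := psi_sum A B C; set b := block_index _ nu => sm /andP[i0 lei] /andP[j0 lej].
have bP (x : 'I_m) : [/\ (0 < b x <= nu)%N, (s 1 (b x).-1 <= x)%N
    & (x < s 1 (b x))%N].
  by apply: block_indexP; have := ltn_ord x; rewrite -[X in (x < X)%N -> _]sm.
have split_s : (s 1 i.-1 + s i nu = m)%N.
  by rewrite -sm /s !psi_sumE [RHS](big_cat_nat (n := i)) //= prednK.
have split_j : (s 1 j.-1 + psi A B C j = s 1 j)%N.
  by rewrite /s !psi_sumE prednK // [RHS]big_nat_recr.
have b_geq (x : 'I_m) : (i <= b x)%N = (s 1 i.-1 <= x)%N.
  have lei1 : (i.-1 <= nu)%N by rewrite -ltnS prednK.
  by rewrite -[i in LHS](prednK i0) ltnNge (block_index_leq _ _ lei1) -leqNgt.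
split=> [PhiPsi x y lex by_ | M0].
  have lta : (x - s 1 i.-1 < s i nu)%N.
    by have := ltn_ord x; move: lex; rewrite b_geq; lia.
  have ltb : (y - s 1 j.-1 < psi A B C j)%N.
    by have [_] := bP y; rewrite by_; lia.
  have := congr1 (fun N => row (Ordinal lta) N) PhiPsi.
  rewrite -mulmxA (row_Phi _ (x := x)) ?row0 => [|/=]; last first.
    by move: lex; rewrite b_geq => lex; rewrite subnKC.
  move=> /rowP/(_ (Ordinal ltb)); rewrite !mxE => E.
  have := congr1 (fun N : 'cV_m => N x 0) (@col_Psi m j M (Ordinal ltb) y _).
  rewrite !mxE E => -> //=.
  by have [_] := bP y; rewrite by_ => ley _; rewrite subnKC.
apply/matrixP => a c; rewrite [RHS]mxE.
have ltx : (s 1 i.-1 + a < m)%N by rewrite -split_s ltn_add2l.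
have lts : (s 1 j <= s 1 nu)%N by apply: leq_offset.
have lty : (s 1 j.-1 + c < m)%N.
  by apply: leq_trans (_ : s 1 j <= m)%N; rewrite -?split_j ?ltn_add2l // split_j -[leqRHS]sm.
have := congr1 (fun N : 'rV_(psi A B C j) => N 0 c)
  (@row_Phi _ i nu (M *m Psi A B C j) a (Ordinal ltx) erefl).
rewrite [LHS]mxE [RHS]mxE mulmxA => ->.
have := congr1 (fun N : 'cV_m => N (Ordinal ltx) 0)
  (@col_Psi m j M c (Ordinal lty) erefl).
rewrite [LHS]mxE [RHS]mxE => ->; apply: M0; first by rewrite b_geq leq_addr.
apply/eqP; rewrite eqn_leq block_index_leq // -[X in (_ < X)%N]split_j ltn_add2l.
rewrite ltn_ord leqNgt /=; apply/negP; rewrite -[X in (_ < X)%N](prednK j0) ltnS.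
by rewrite block_index_leq ?ltnNge ?leq_addr // ltnW // prednK.
Qed.

End Selection.

Section PsiSums.

Variables (K : realType) (n m : nat).
Variables (A : 'M[K]_n) (B : 'M[K]_(n, m)) (C : 'M[K]_(m, n)).

(** Truncated differences telescope to an upper bound without monotonicity of [phi]. *)
Lemma phi_leq_psi_sum (k : nat) : (phi A B C k <= psi_sum A B C 1 k)%N.
Proof.
rewrite psi_sumE; elim: k => [|k IH]; first by rewrite /phi subnn.
by rewrite big_nat_recr //= /psi -leq_subLR leq_sub2l.
Qed.

End PsiSums.

(** * Leading rows of F and nonsingularity of R_1 *)

Section LeadingRows.

Variables (K : realType) (n m nu : nat).
Variables (A : 'M[K]_n) (B : 'M[K]_(n, m)) (C : 'M[K]_(m, n)).
Variables (U : 'M[K]_(\sum_(j < nu) m, \sum_(k < nu) m)).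
Variables (Fd : forall i : nat, 'M[K]_(psi A B C i, m)).
Variables (F R : 'M[K]_(m, \sum_(k < nu) m)).
Hypothesis phi_nu : phi A B C nu = m.
Hypothesis hU : rref_of (Qi A B C nu) U.
Hypothesis hFd : F_choice U Fd.
Hypothesis hF : block_upper Fd F.
Hypothesis hR : R *m Qi A B C nu = F.

Let b (x : 'I_m) := block_index (psi A B C) nu x.

(** The earlier spaces lie in im (E_k^T), which meets im (F_(k+1)^T) only in 0; so the sum is direct
    and the ranks add up. *)
Lemma F_choice_sum (k : nat) : (k <= nu)%N ->
  \rank (\sum_(i < k) <<Fd i.+1>>)%MS = psi_sum A B C 1 k /\
  (\sum_(i < k) <<Fd i.+1>> <= Eblk U k)%MS.
Proof.
rewrite psi_sumE; elim: k => [|k IH] ltk.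
  by rewrite !big_ord0 mxrank0 big_geq ?sub0mx.
have [rk sub] := IH (ltnW ltk); rewrite big_ord_recr /= big_nat_recr //=.
have [rF FE] := hFd (i := k.+1) ltk; split.
  rewrite -rk -[in RHS]rF -(mxrank_gen (Fd k.+1)) -mxrank_sum_cap.
  suff -> : (\sum_(i < k) <<Fd i.+1>> :&: <<Fd k.+1>>)%MS = 0.
    by rewrite mxrank0 addn0.
  apply/eqP/rowV0P => v; rewrite sub_capmx genmxE => /andP[vs vF].
  apply/eqP; apply: contraT => v0; have [_] := FE v vF v0.
  by rewrite (submx_trans vs sub).
rewrite addsmx_sub genmxE (submx_trans sub (Eblk_nested hU ltk)) /=.
apply/row_subP => a; have [->|r0] := eqVneq (row a (Fd k.+1)) 0.
  exact: sub0mx.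
by have [] := FE _ (row_sub a _) r0.
Qed.

Lemma psi_sum_total : psi_sum A B C 1 nu = m.
Proof.
apply/eqP; rewrite eqn_leq; apply/andP; split; last first.
  by rewrite -[leqLHS]phi_nu phi_leq_psi_sum.
by have [<- _] := F_choice_sum (leqnn nu); apply: rank_leq_col.
Qed.

Lemma row_blockP (x : 'I_m) :
  [/\ (0 < b x <= nu)%N, (psi_sum A B C 1 (b x).-1 <= x)%N
    & (x < psi_sum A B C 1 (b x))%N].
Proof.
apply: block_indexP; rewrite -psi_sumE psi_sum_total; exact: ltn_ord.
Qed.

Lemma row_block (x : 'I_m) :
  exists a : 'I_(psi A B C (b x)),
    x = (psi_sum A B C 1 (b x).-1 + a)%N :> nat.
Proof.
have [/andP[b0 _] ge lt] := row_blockP x.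
have lta : (x - psi_sum A B C 1 (b x).-1 < psi A B C (b x))%N.
  rewrite ltn_subLR // (leq_trans lt) // !psi_sumE prednK //.
  by rewrite [leqLHS]big_nat_recr.
by exists (Ordinal lta); rewrite /= subnKC.
Qed.

Lemma row_F_eq0 (x : 'I_m) (k : nat) : (k < b x)%N -> row x (colblk F k) = 0.
Proof.
case: k => [|k] ltk; first by rewrite colblk0 row0.
have [rg _ _] := row_blockP x; have [_ F0] := hF rg.
have [a ea] := row_block x.
by rewrite -(row_trPsi _ ea) F0 ?row0.
Qed.

Definition leading_mx : 'M[K]_m := \matrix_x row x (colblk F (b x)).

Lemma row_leading_mx_sub (x : 'I_m) : (row x leading_mx <= Fd (b x))%MS.
Proof.
have [rg _ _] := row_blockP x; have [Fb _] := hF rg.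
have [a ea] := row_block x.
by rewrite rowK -(row_trPsi _ ea) Fb row_sub.
Qed.

(** The row space contains that of every F_i, and these together have rank m. *)
Lemma leading_mx_unit : leading_mx \in unitmx.
Proof.
rewrite -row_full_unit -col_leq_rank -[leqLHS]psi_sum_total.
have [<- _] := F_choice_sum (leqnn nu); apply: mxrankS.
apply/sumsmx_subP => i _; rewrite genmxE.
have lti := ltn_ord i; have [Fi _] := hF (i := i.+1) lti.
apply/row_subP => a; rewrite -Fi.
have lts : (psi_sum A B C 1 i.+1 <= psi_sum A B C 1 nu)%N by apply: leq_offset.
have split_s : psi_sum A B C 1 i.+1 = (psi_sum A B C 1 i + psi A B C i.+1)%N.
  by rewrite !psi_sumE big_nat_recr.
have ltx : (psi_sum A B C 1 i + a < m)%N.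
  apply: leq_trans (_ : psi_sum A B C 1 i.+1 <= m)%N.
    by rewrite split_s ltn_add2l.
  by rewrite -[leqRHS]psi_sum_total.
rewrite (row_trPsi _ (y := Ordinal ltx)) //.
suff eb : b (Ordinal ltx) = i.+1.
  by have := row_sub (Ordinal ltx) leading_mx; rewrite rowK eb.
apply/eqP; rewrite eqn_leq [X in X && _]block_index_leq // -psi_sumE split_s.
rewrite ltn_add2l ltn_ord ltnNge block_index_leq ?(ltnW lti) //.
by rewrite -psi_sumE -leqNgt leq_addr.
Qed.

(* Read in power series: q(0) = v R_1 and q M = O(z^t) force
   v F = (v R - q) M + O(z^t), whose first factor is divisible by z; a leading
   coefficient of v F in block a <= t would then lie in im (E_(a-1)^T). *)
Lemma leading_order (v : 'rV[K]_m) (x : 'rV[K]_(\sum_(j < nu) m)) (t : nat) :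
  (t <= nu)%N -> colblk x nu = v *m colblk R nu ->
  (forall k, (k <= t)%N -> colblk (x *m Qi A B C nu) k = 0) ->
  forall y, (b y <= t)%N -> v 0 y = 0.
Proof.
move=> let1 x1 x0 y0 ley0; apply/eqP; apply: contraT => vy0.
(* Choosing y in the lowest block met by v makes block b(y) the first where v F can be nonzero. *)
have [y vy miny] := @arg_minnP _ y0 (fun y => v 0 y != 0) b vy0.
have lea : (b y <= t)%N by apply: leq_trans (miny _ vy0) ley0.
have [rg _ _] := row_blockP y; have /andP[a0 lean] := rg.
have E k : colblk ((v *m R - x) *m Qi A B C nu) k =
    v *m colblk F k - colblk (x *m Qi A B C nu) k.
  by rewrite mulmxBl colblkB -mulmxA hR (colblk_mulmx v).
have vF k : (k <= b y)%N -> v *m colblk F k =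
    \sum_z (if b z == k then v 0 z else 0) *: row z leading_mx.
  move=> lek; rewrite mulmx_sum_row; apply: eq_bigr => z _.
  rewrite rowK; have [->//|ne] := eqVneq (b z) k.
  rewrite scale0r; have [->|vz] := eqVneq (v 0 z) 0; first by rewrite scale0r.
  by rewrite row_F_eq0 ?scaler0 // ltn_neqAle eq_sym ne (leq_trans lek) // miny.
have vF0 k : (k < b y)%N -> v *m colblk F k = 0.
  move=> ltk; rewrite (vF _ (ltnW ltk)) big1 // => z _.
  case: eqP => [bz|]; last by rewrite scale0r.
  have [->|vz] := eqVneq (v 0 z) 0; first by rewrite scale0r.
  by have := miny _ vz; rewrite bz leqNgt ltk.
have div : (v *m colblk F (b y) <= Eblk U (b y).-1)%MS.
  have -> : v *m colblk F (b y) =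
      colblk ((v *m R - x) *m Qi A B C nu) (b y).-1.+1.
    by rewrite prednK // E (x0 _ lea) subr0.
  apply: (Eblk_divided hU); first by rewrite prednK.
    by rewrite colblkB colblk_mulmx x1 subrr.
  move=> k lek; have ltk : (k < b y)%N by rewrite -(prednK a0) ltnS.
  by rewrite E vF0 // x0 ?subrr // ltnW // (leq_trans ltk).
(* The leading coefficient of v F lies in im (F_(b(y))^T) and is nonzero because [leading_mx] is
   invertible, so [div] contradicts the choice of the F_i. *)
have [_ /(_ (v *m colblk F (b y)))] := hFd rg.
case=> //; first 1 last.
- apply/eqP; rewrite vF // => u0.
  have : (\row_z (if b z == b y then v 0 z else 0)) *m leading_mx = 0.
    by rewrite mulmx_sum_row -[RHS]u0; apply: eq_bigr => z _; rewrite mxE.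
  move=> /(congr1 (mulmx^~ (invmx leading_mx))); rewrite mulmxK ?leading_mx_unit //.
  by rewrite mul0mx => /rowP/(_ y)/eqP; rewrite !mxE eqxx (negPf vy).
- by move=> _; rewrite div.
- rewrite vF //; apply: summx_sub => z _; case: eqP => [<-|_].
    by apply: scalemx_sub; apply: row_leading_mx_sub.
  by rewrite scale0r sub0mx.
Qed.

(** The last block of R is R_1. If v R_1 = 0, then q = 0 satisfies the hypotheses of [leading_order]
    with t = nu. *)
Lemma R1_unit : colblk R nu \in unitmx.
Proof.
rewrite -row_free_unit -kermx_eq0; apply/rowV0P => v /sub_kermxP vR0.
apply/rowP => y; rewrite [RHS]mxE.
apply: (@leading_order v 0 nu) => // [|k _|].
- by rewrite vR0 -(mul0mx _ R) colblk_mulmx mul0mx.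
- by rewrite colblk_mulmx mul0mx.
- by have [/andP[]] := row_blockP y.
Qed.

End LeadingRows.

(** * Orders of products with a row-reduced power series *)

Section RowOrders.

Variables (K : realType) (m : nat).

(** Independent leading rows of Y exclude cancellation of lowest-order terms in X Y. The induction
    is on p = q + d(y), the order of the contribution of the coefficient [X q 0 y]. *)
Lemma row_order_reduced (X : nat -> 'rV[K]_m) (Y : nat -> 'M[K]_m)
    (d : 'I_m -> nat) (e : nat) :
  (forall y k, (k < d y)%N -> row y (Y k) = 0) ->
  \matrix_y row y (Y (d y)) \in unitmx ->
  (forall k, (k < e)%N -> \sum_(q < k.+1) X q *m Y (k - q)%N = 0) ->
  forall q y, (q + d y < e)%N -> X q 0 y = 0.
Proof.
move=> Y0 unitY XY0 q y; move: {2}(q + d y)%N (erefl (q + d y)%N) => p.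
elim/ltn_ind: p q y => p IH q y eqp lte; rewrite eqp in lte.
(* The coefficient of z^p in X Y reduces to u times the leading rows: all other terms vanish by
   induction or by [Y0]. *)
pose u : 'rV_m := \row_z (if (d z <= p)%N then X (p - d z)%N 0 z else 0).
suff u0 : u = 0.
  have := congr1 (fun w : 'rV_m => w 0 y) u0.
  by rewrite !mxE -eqp leq_addl addnK.
have : u *m (\matrix_z row z (Y (d z))) = 0.
  rewrite -(XY0 _ lte); under [RHS]eq_bigr do rewrite mulmx_sum_row.
  rewrite exchange_big mulmx_sum_row; apply: eq_bigr => z _ /=.
  rewrite rowK mxE; case: leqP => [led|gtd]; last first.
    rewrite scale0r big1 // => k _; rewrite Y0 ?scaler0 //; lia.
  have ltk : (p - d z < p.+1)%N by lia.
  rewrite (bigD1 (Ordinal ltk)) //= subKn // big1 ?addr0 // => k nek.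
  have {}nek : (k : nat) <> (p - d z)%N.
    by move=> ek; case/eqP: nek; apply: val_inj.
  have [ltd|ged] := ltnP (p - k) (d z); first by rewrite Y0 ?scaler0.
  rewrite (IH (k + d z)%N _ k z erefl) ?scale0r //; have := ltn_ord k; lia.
by move=> /(congr1 (mulmx^~ (invmx (\matrix_z row z (Y (d z)))))); rewrite mulmxK // mul0mx.
Qed.

End RowOrders.

(** * Coefficients of R(z) W(z) and S(z) *)

Section OutputInjection.

Variables (K : realType) (n m nu : nat).
Variables (A : 'M[K]_n) (B : 'M[K]_(n, m)) (C : 'M[K]_(m, n)) (L : 'M[K]_(n, m)).

(** W(0) = I, so multiplication by W keeps the constant term. *)
Lemma colblk_mul_Omega_last (p : nat) (X : 'M[K]_(p, \sum_(k < nu) m)) :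
  (0 < nu)%N -> colblk (X *m Omega_o A C nu L) nu = colblk X nu.
Proof.
move=> nu0; have ltk : (nu.-1 < nu)%N by rewrite prednK.
have := colblk_mul_mxblock X
  (fun j k : 'I_nu => if j == k then 1%:M
     else if (k < j)%N then - (C *m A ^+ (j - k - 1) *m L) else 0) (Ordinal ltk).
rewrite /= prednK // => ->.
rewrite (bigD1 (Ordinal ltk)) //= eqxx mulmx1 prednK // big1 ?addr0 // => j nej.
by rewrite (negPf nej) leqNgt ltn_ord mulmx0.
Qed.

Lemma rblk_Smx (R : 'M[K]_(m, \sum_(k < nu) m)) (q : nat) :
  colblk R nu \in unitmx ->
  rblk (Smx A C R L) q.+1 *m colblk R nu = colblk (R *m Omega_o A C nu L) (nu - q).
Proof.
move=> R1; have -> : rblk (Smx A C R L) q.+1 =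
    colblk (R *m Omega_o A C nu L) (nu - q) *m invmx (colblk R nu).
  by rewrite [LHS]colblk_mul_mxdiag /rblk subSS subn1.
exact: mulmxKV.
Qed.

End OutputInjection.

Lemma row_unitmx_neq0 (K : fieldType) (m : nat) (M : 'M[K]_m) (x : 'I_m) :
  M \in unitmx -> row x M != 0.
Proof.
move=> uM; apply/eqP; rewrite rowE => /(congr1 (mulmx^~ (invmx M))).
rewrite mulmxK // mul0mx => /rowP/(_ x)/eqP.
by rewrite !mxE !eqxx oner_eq0.
Qed.

(** * The equations for S(L) and regularity of the relative degree *)

Section RegularOutputInjection.

Variables (K : realType) (n m nu : nat).
Variables (A : 'M[K]_n) (B : 'M[K]_(n, m)) (C : 'M[K]_(m, n)).
Variables (U : 'M[K]_(\sum_(j < nu) m, \sum_(k < nu) m)).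
Variables (Fd : forall i : nat, 'M[K]_(psi A B C i, m)).
Variables (F R : 'M[K]_(m, \sum_(k < nu) m)).
Variable L : 'M[K]_(n, m).
Hypothesis hnu : (0 < nu <= n)%N.
Hypothesis phi_nu : phi A B C nu = m.
Hypothesis hU : rref_of (Qi A B C nu) U.
Hypothesis hFd : F_choice U Fd.
Hypothesis hF : block_upper Fd F.
Hypothesis hR : R *m Qi A B C nu = F.

Let b (x : 'I_m) := block_index (psi A B C) nu x.
Let AL := A + L *m C.
(** Coefficients of S(z) and N(z): [S q] is the matrix S_(q+1)(L). *)
Let S (q : nat) := rblk (Smx A C R L) q.+1.
Let N (k : nat) := colblk R nu *m (C *m AL ^+ k *m B).

Let nu0 : (0 < nu)%N.
Proof. by case/andP: hnu. Qed.

Let unitR1 : colblk R nu \in unitmx.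
Proof. exact: R1_unit phi_nu hU hFd hF hR. Qed.

Let b_range (x : 'I_m) : (0 < b x <= nu)%N.
Proof. by have [] := row_blockP phi_nu hU hFd x. Qed.

Lemma colblk_F (k : nat) : (k < nu)%N ->
  colblk F k.+1 = \sum_(q < k.+1) S q *m N (k - q)%N.
Proof.
move=> ltk; rewrite -hR (Qi_output_injection nu A B C L) mulmxA colblk_mul_Qi //.
by apply: eq_bigr => q _; rewrite /S /N [RHS]mulmxA rblk_Smx.
Qed.

Lemma S0 : S 0 = 1%:M.
Proof.
have := rblk_Smx A C L 0 unitR1; rewrite subn0 colblk_mul_Omega_last // -/(S 0).
by move=> /(congr1 (mulmx^~ (invmx (colblk R nu)))); rewrite mulmxK // mulmxV.
Qed.

(** The order condition on S(z); for q = 0 it follows from [S0]. *)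
Let S_low := forall q x y, (0 < q)%N -> (q + b y < b x)%N -> S q x y = 0.

(** Solve S N = F for N k: in each term with q > 0 either the row of N vanishes by induction or the
    entry of S does by [S_low]. *)
Lemma N_order : S_low -> forall x k, (k.+1 < b x)%N -> row x (N k) = 0.
Proof.
move=> low x k; elim/ltn_ind: k x => k IH x ltb.
have /andP[_ len] := b_range x.
have ltk : (k < nu)%N by lia.
have := row_F_eq0 phi_nu hU hFd hF ltb.
rewrite colblk_F // big_ord_recl S0 mul1mx subn0 linearD linear_sum /=.
rewrite big1 ?addr0 // => q _; rewrite /bump add1n row_mul mulmx_sum_row.
rewrite big1 // => y _; rewrite mxE; have ltq := ltn_ord q.
have [ltN|geN] := ltnP (k - q.+1).+1 (b y).
  by rewrite IH ?scaler0 //; lia.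
by rewrite low ?scale0r //; lia.
Qed.

(** Comparing coefficients of z^(b(x)-1) in S N = F, only leading rows of N survive, so they span
    the leading rows of F. *)
Lemma N_leading : S_low -> \matrix_x row x (N (b x).-1) \in unitmx.
Proof.
move=> low; have unitF := leading_mx_unit phi_nu hU hFd hF.
suff sub : (leading_mx A B C F <= \matrix_x row x (N (b x).-1))%MS.
  rewrite -row_full_unit -col_leq_rank (leq_trans _ (mxrankS sub)) //.
  by rewrite col_leq_rank row_full_unit.
apply/row_subP => x; rewrite rowK -/(b x).
have /andP[b0 len] := b_range x.
rewrite -(prednK b0) colblk_F ?prednK // linear_sum /=.
apply: summx_sub => q _; rewrite row_mul mulmx_sum_row.
apply: summx_sub => y _; rewrite mxE; have ltq := ltn_ord q.
have [ltN|gtN|eqN] := ltngtP ((b x).-1 - q).+1 (b y).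
- by rewrite N_order ?scaler0 ?sub0mx.
- have [q0|q0] := posnP q; last by rewrite low ?scale0r ?sub0mx //; lia.
  rewrite q0 S0 mxE; have [xy|] := eqVneq x y; last by rewrite scale0r sub0mx.
  by move: gtN b0; rewrite q0 xy; lia.
apply: scalemx_sub; have -> : ((b x).-1 - q)%N = (b y).-1 by rewrite -eqN.
rewrite (_ : row y _ = row y (\matrix_z row z (N (b z).-1))) ?row_sub //.
by rewrite rowK.
Qed.

Let markov_row (T : 'M[K]_m) (x : 'I_m) (k : nat) :
  row x (T *m C) *m AL ^+ k *m B = row x (T *m (C *m AL ^+ k *m B)).
Proof. by rewrite !row_mul !mulmxA. Qed.

Lemma S_low_regular :
  S_low -> has_regular_relative_degree AL B (colblk R nu *m C).
Proof.
move=> low; have /andP[_ leqn] := hnu.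
have coupl : coupling_mx AL B (colblk R nu *m C) b = \matrix_x row x (N (b x).-1).
  by apply/row_matrixP => x; rewrite !rowK markov_row.
exists b; last by rewrite coupl; apply: N_leading.
move=> x; have /andP[b0 len] := b_range x; split.
- by rewrite b0 (leq_trans len).
- by move=> j ltj; rewrite markov_row N_order.
- by have := row_unitmx_neq0 x (N_leading low); rewrite -coupl rowK.
Qed.

Lemma regular_S_low (T : 'M[K]_m) : T \in unitmx ->
  has_regular_relative_degree AL B (T *m C) -> S_low.
Proof.
move=> unitT [r rdeg unitG] q x z q0 ltq.
pose Y k := T *m (C *m AL ^+ k *m B).
pose V := colblk R nu *m invmx T.
have Y_order y k : (k < (r y).-1)%N -> row y (Y k) = 0.
  by move=> ltk; have [_ Y0 _] := rdeg y; rewrite -markov_row Y0 //; lia.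
have Y_lead : \matrix_y row y (Y (r y).-1) \in unitmx.
  suff <- : coupling_mx AL B (T *m C) r = \matrix_y row y (Y (r y).-1) by [].
  by apply/row_matrixP => y; rewrite !rowK markov_row.
have r_pos y : (0 < r y)%N by have [/andP[]] := rdeg y.
(* Row x of (S V)(T M_L) = F vanishes below z^(b(x)-1), and T M_L is row-reduced with orders r(y) -
   1. *)
have SV y : (q + r y < b x)%N -> (S q *m V) x y = 0.
  move=> lty; have := r_pos y => ry.
  have := @row_order_reduced K m (fun k => row x (S k *m V)) Y
    (fun y => (r y).-1) (b x).-1 Y_order Y_lead.
  have XY0 k : (k < (b x).-1)%N ->
      \sum_(l < k.+1) row x (S l *m V) *m Y (k - l)%N = 0.
    move=> ltk; have /andP[_ len] := b_range x.
    transitivity (row x (colblk F k.+1)); last first.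
      by apply: (row_F_eq0 phi_nu hU hFd hF); rewrite -/(b x); lia.
    rewrite colblk_F ?linear_sum /=; last lia.
    apply: eq_bigr => l _; rewrite -row_mul /N /Y /V !mulmxA.
    by rewrite mulmxKV.
  move=> /(_ XY0 q y); rewrite mxE => -> //; lia.
(* Here e is row y of T as a constant series. Injecting -L into A + L C gives back A, so w M = e
   M_L, of order r(y) - 1, while w(0) = (T R_1^-1)_y R_1: the setting of [leading_order]. The
   minimum with nu is taken since r(y) is bounded only by n. *)
have VI y : (b z < r y)%N -> (T *m invmx (colblk R nu)) y z = 0.
  move=> lty; pose t := minn (r y).-1 nu.
  pose e := blockrow nu (fun k => if k == nu.-1 then row y T else 0).
  pose w := e *m Omega_o AL C nu (- L).
  have e_last : colblk e nu = row y T by rewrite colblk_blockrow ?nu0 /= ?eqxx.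
  have wQ : w *m Qi A B C nu = e *m Qi AL B C nu.
    rewrite /w -mulmxA (Qi_output_injection nu AL B C (- L)).
    by rewrite mulNmx /AL addrK.
  have w0 k : (k <= t)%N -> colblk (w *m Qi A B C nu) k = 0.
    case: k => [//|k]; rewrite leq_min => /andP[ltr ltk].
    rewrite wQ colblk_mul_Qi // big_ord_recl subn0 e_last subn0.
    rewrite -row_mul Y_order // add0r big1 // => l _; rewrite lift0.
    have ltl := ltn_ord l; rewrite colblk_blockrow; last lia.
    rewrite ifN ?mul0mx //; lia.
  have w_last : colblk w nu = row y (T *m invmx (colblk R nu)) *m colblk R nu.
    by rewrite colblk_mul_Omega_last // e_last -row_mul mulmxKV.
  have := leading_order phi_nu hU hFd hF hR (geq_minr _ _) w_last w0 (y := z).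
  rewrite mxE; apply.
  rewrite -/(b z) leq_min; have := b_range z; lia.
have -> : S q = (S q *m V) *m (T *m invmx (colblk R nu)).
  by rewrite /V -!mulmxA mulKmx // mulmxV // mulmx1.
rewrite mxE big1 // => y _.
(* Otherwise r(y) <= b(z), hence q + r(y) < b(x) and the other factor vanishes. *)
have [lty|ley] := ltnP (b z) (r y); first by rewrite VI ?mulr0.
by rewrite SV ?mul0r //; lia.
Qed.

(** Put i = q + 1 and j = b(y): the condition q + b(y) < b(x) becomes i + j <= b(x), and b(x) <= nu
    yields the stated ranges. *)
Lemma S_lowP :
  S_low <->
  (forall i j : nat, (2 <= i <= nu - 1)%N -> (1 <= j <= nu - i)%N ->
     Phi A B C (i + j) nu *m rblk (Smx A C R L) i *m Psi A B C j = 0).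
Proof.
have total : psi_sum A B C 1 nu = m by apply: psi_sum_total phi_nu hU hFd.
split=> [low i j hi hj | eqs q x y q0 ltb].
  apply/Phi_mul_Psi_eq0 => //; try lia.
  case: i hi hj => [|q] hi hj x y ix jy; first lia.
  by apply: low; rewrite /b ?jy; lia.
have := b_range x; have := b_range y => hy hx.
have hi : (0 < q.+1 + b y <= nu.+1)%N by lia.
apply: (proj1 (Phi_mul_Psi_eq0 (S q) total hi hy) _ x y) => //.
by apply: eqs; lia.
Qed.

End RegularOutputInjection.

Theorem theorem2 (K : realType) (n m : nat)
    (A : 'M[K]_n) (B : 'M[K]_(n, m)) (C : 'M[K]_(m, n))
    (hinv : invertible A B C)
    (nu : nat) (hnu : is_nistar A B C nu) (hnu3 : (3 <= nu)%N)
    (U : 'M[K]_(\sum_(j < nu) m, \sum_(k < nu) m))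
    (hU : rref_of (Qi A B C nu) U)
    (Fd : forall i : nat, 'M[K]_(psi A B C i, m))
    (hFd : F_choice U Fd)
    (F R : 'M[K]_(m, \sum_(k < nu) m))
    (hF : block_upper Fd F)
    (hR : R *m Qi A B C nu = F)
    (L : 'M[K]_(n, m)) :
  (exists2 Ty : 'M[K]_m, Ty \in unitmx
     & has_regular_relative_degree (A + L *m C) B (Ty *m C))
  <->
  (forall i j : nat, (2 <= i <= nu - 1)%N -> (1 <= j <= nu - i)%N ->
     Phi A B C (i + j) nu *m rblk (Smx A C R L) i *m Psi A B C j = 0).
Proof.
have [rg phi_nu _] := hnu.
split=> [[T unitT reg] | eqs].
  apply/(S_lowP L rg phi_nu hU hFd hF hR).
  exact: regular_S_low rg phi_nu hU hFd hF hR _ unitT reg.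
exists (colblk R nu); first exact: R1_unit phi_nu hU hFd hF hR.
apply: (S_low_regular rg phi_nu hU hFd hF hR _).
exact/(S_lowP L rg phi_nu hU hFd hF hR).
Qed.
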